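(* Let $n\ge 1$, let $D$ be the odd diagram of some permutation in $S_n$, and let $\mathrm{Perm}(D)=\{w\in S_n : D_o(w)=D\}$ be its odd diagram class, which is a Bruhat interval $[u,v]$ in $S_n$. Then the Poincaré polynomial $$P_{u,v}(t)=t^{-\ell(u)}\sum_{u\le w\le v}t^{\ell(w)}$$ of $\mathrm{Perm}(D)$ can be expressed as a finite product of polynomials of the form $1+t+\cdots+t^m$ (with integers $m\ge 0$).
   Context: $S_n$ is the symmetric group of permutations of $[n]=\{1,\dots,n\}$. The Coxeter length $\ell(w)$ of $w\in S_n$ is the number of pairs $i<j$ with $w(i)>w(j)$. For $i<j$, $w\,(i\ j)$ is the permutation obtained from $w$ by swapping the values $w(i)$ and $w(j)$ (at positions $i$ and $j$). The Bruhat order $\le$ on $S_n$ is the reflexive transitive closure of the relations $w<w\,(i\ j)$ for $i<j$ and $w(i)<w(j)$; $[u,v]=\{w\in S_n: u\le w\le v\}$. The odd diagram of $w\in S_n$ is $$D_o(w)=\{(i,j)\in[n]\times[n] : w(i)>j,\ i<w^{-1}(j),\ i\not\equiv w^{-1}(j) \pmod 2\}.$$ A subset $D\subseteq[n]\times[n]$ is an odd diagram if $D=D_o(w)$ for some $w\in S_n$. Its odd diagram class is $\mathrm{Perm}(D)=\{w\in S_n: D_o(w)=D\}$. It is a known theorem (Brenti, Carnevale and Tenner) that each odd diagram class is an interval $[u,v]$ in the Bruhat order. *)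

(* Defs.v *)
From mathcomp Require Import all_boot all_order all_algebra all_fingroup.
From mathcomp Require Import zify.

Set Implicit Arguments.
Unset Strict Implicit.
Unset Printing Implicit Defensive.

Import GRing.Theory.

(* Permutations of [n] = {1, .., n} are represented by 'S_n, acting on
   'I_n = {0, .., n - 1}; both positions and values are shifted by one, which
   affects neither the comparisons nor the parity condition below. *)

Definition coxeter_length (n : nat) (w : 'S_n) : nat :=
  #|[set p : 'I_n * 'I_n | (p.1 < p.2) && (w p.2 < w p.1)]|.

(* Products in 'S_n compose from left to right, so that tperm i j * w maps k to
   w (tperm i j k): it swaps the values at positions i and j. *)
Definition bruhat_step (n : nat) : rel 'S_n := fun u v =>
  [exists i : 'I_n, exists j : 'I_n,
    [&& i < j, u i < u j & v == (tperm i j * u)%g]].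

Definition bruhat_le (n : nat) : rel 'S_n := connect (@bruhat_step n).

Definition bruhat_interval (n : nat) (u v : 'S_n) : {set 'S_n} :=
  [set w | bruhat_le u w && bruhat_le w v].

Definition odd_diagram (n : nat) (w : 'S_n) : {set 'I_n * 'I_n} :=
  [set p : 'I_n * 'I_n | [&& p.2 < w p.1, p.1 < (w^-1)%g p.2
                           & odd p.1 != odd ((w^-1)%g p.2)]].

Definition is_odd_diagram (n : nat) (D : {set 'I_n * 'I_n}) : Prop :=
  exists w : 'S_n, odd_diagram w = D.

Definition odd_diagram_class (n : nat) (D : {set 'I_n * 'I_n}) : {set 'S_n} :=
  [set w | odd_diagram w == D].

Local Open Scope ring_scope.

(* The subtraction in nat never truncates, by bruhat_le_length, so this
   is t^(- l(u)) * \sum_w t^(l(w)); see poincareE. *)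
Definition poincare (n : nat) (u v : 'S_n) : {poly int} :=
  \sum_(w in bruhat_interval u v) 'X^(coxeter_length w - coxeter_length u)%N.

Lemma bruhat_step_length (n : nat) (u v : 'S_n) :
  bruhat_step u v -> (coxeter_length u <= coxeter_length v)%N.
Proof.
case/existsP=> i /existsP[j /and3P[ltij ltu /eqP->]].
pose t := tperm i j.
pose f (p : 'I_n * 'I_n) :=
  if (t p.1 < t p.2)%N then (t p.1, t p.2) else p.
rewrite /coxeter_length; set A := [set p | _]; set B := [set p | _].
have fK : {in A, cancel f f}.
  case=> a b; rewrite inE /= => /andP[ltab _]; rewrite /f /=.
  case h: (t a < t b)%N => /=; last by rewrite h.
  by rewrite /t !tpermK ltab.
rewrite -(card_in_imset (can_in_inj fK)).
apply/subset_leq_card/subsetP=> _ /imsetP[[a b] + ->].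
rewrite !inE /= => /andP[ltab ltw]; rewrite /f /=.
case: ifP => /= [h|/negbT]; first by rewrite h !permM -/t !tpermK.
rewrite ltab !permM -/t -leqNgt /t /=.
case: tpermP => [eb|eb|/eqP nbi /eqP nbj];
  case: tpermP => [ea|ea|/eqP nai /eqP naj]; subst=> //=; lia.
Qed.

Lemma bruhat_le_length (n : nat) (u v : 'S_n) :
  bruhat_le u v -> (coxeter_length u <= coxeter_length v)%N.
Proof.
case/connectP=> p + ->; elim: p u => [|x p IHp] u //= /andP[/bruhat_step_length].
by move=> le_ux /IHp; apply: leq_trans.
Qed.

Lemma poincareE (n : nat) (u v : 'S_n) :
  'X^(coxeter_length u) * poincare u v =
  \sum_(w in bruhat_interval u v) 'X^(coxeter_length w).
Proof.
rewrite mulr_sumr; apply: eq_bigr => w; rewrite inE => /andP[le_uw _].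
by rewrite -exprD subnKC // bruhat_le_length.
Qed.

(* Main.v *)
Require Import Defs.
From mathcomp Require Import all_boot all_order all_algebra all_fingroup.
From mathcomp Require Import zify.

Import GRing.Theory Num.Theory.

(** Build a permutation of the class one value at a time, in increasing order
    of values.  Suppose that the positions of all values below j are chosen,
    and let E be the set of positions that the value j takes in the members of
    the class that respect these choices.

    If w and w' are two such members, with j at position i in w and at position
    k in w', then exchanging the values at positions i and k of w again gives a
    member of the class ([prefix_class_exchange], [swap_mem_prefix_class]).
    Indeed the column j of the diagram lists the positions of parity opposite
    to that of j, left of j, whose values exceed j; since it is the same for w
    and w', the positions i and k have the same parity, and every position of
    the other parity between them already carries a value below j.  And if some
    p of the other parity, right of i and k, had j < w(p) < w(k), then the
    diagram would contain (k, w(p)), which is impossible in w' as w'(k) = j.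
    These are the conditions under which an exchange preserves the odd
    diagram ([odd_diagram_swap]).

    If moreover i and k are consecutive in E, no position between them has
    a value between j and w(k): such a position would have the parity of i, so
    it could be exchanged with i, and it would lie in E.  Hence the exchange
    raises the length by exactly 1.  So it is a bijection from the members with
    j at i to those with j at k which multiplies the weight t^l by t
    ([prefix_class_sum_shift]), and the whole sum is 1 + t + ... + t^(#|E| - 1)
    times its part with j at the leftmost position of E.  Fixing j there and
    passing to the next value, one gets that the sum of t^l over the class is
    a power of t times a product of such factors ([prefix_class_sum]).  The
    power is t^l(u), because u is the shortest element of the interval. *)

(** * Exchanging the values at two positions *)

Lemma perm_ltn_total (n : nat) (w : 'S_n) (x y : 'I_n) :
  x <> y -> ((x < y) || (y < x)) && ((w x < w y) || (w y < w x)).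
Proof.
by move=> nxy; rewrite -!neq_ltn !val_eqE (inj_eq perm_inj) andbb; apply/eqP.
Qed.

(** Apart from (i, k) itself, the inversions of the two permutations correspond
    through the map f which applies t = tperm i k to both positions of a pair,
    unless this would reverse their order, in which case it fixes the pair.
    In the latter case the pair consists of i or k and of a position in between,
    whose value lies on the same side of w i and w k. *)
Lemma coxeter_length_cover (n : nat) (w : 'S_n) (i k : 'I_n) :
  i < k -> w i < w k ->
  (forall p : 'I_n, i < p < k -> ~~ (w i < w p < w k)) ->
  coxeter_length (tperm i k * w)%g = (coxeter_length w).+1.
Proof.
move=> ltik ltw none.
pose t := tperm i k.
pose f (p : 'I_n * 'I_n) :=
  if (p.1 < p.2) == (t p.1 < t p.2) then (t p.1, t p.2) else p.
have fK : involutive f.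
  case=> a b; rewrite /f /=; case h: ((a < b) == (t a < t b)) => /=.
    by rewrite /t !tpermK eq_sym h.
  by rewrite h.
rewrite /coxeter_length -[in RHS](card_preimset _ (can_inj fK)).
set A := f @^-1: _.
have tie : f (i, k) = (i, k).
  by rewrite /f /= /t tpermL tpermR ltik ltnNge (ltnW ltik).
have nA : (i, k) \notin A.
  by rewrite !inE tie /= ltik /= -leqNgt ltnW.
suff -> : [set p : 'I_n * 'I_n | p.1 < p.2 & (t * w)%g p.2 < (t * w)%g p.1]
          = (i, k) |: A by rewrite cardsU1 nA.
apply/setP=> -[a b]; rewrite !inE xpair_eqE !permM /f /=.
have ha := none a; have hb := none b.
have e1 := perm_ltn_total _ w a i; have e2 := perm_ltn_total _ w a k.
have e3 := perm_ltn_total _ w b i; have e4 := perm_ltn_total _ w b k.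
rewrite /t -!val_eqE /=.
case: (tpermP i k a) => [ea|ea|/e1 lai /e2 lak]; case: (tpermP i k b) => [eb|eb|/e3 lbi /e4 lbk];
  rewrite ?ea ?eb /= in ha hb *; unfold reverse_coercion in *;
  case: ifP => /=; lia.
Qed.

Lemma mem_odd_diagram (n : nat) (w : 'S_n) (q p : 'I_n) :
  ((q, w p) \in odd_diagram w) = [&& w p < w q, q < p & odd q != odd p].
Proof. by rewrite inE /= permK. Qed.

(** These conditions make the exchange of the values at positions i and k
    harmless for the odd diagram.  In terms of the positions p of the other
    parity: the columns w i and w k stay the same if no value larger than
    w i sits between i and k, and the rows i and k stay the same if moreover no
    value between w i and w k sits to the right of i or k. *)
Definition swappable (n : nat) (w : 'S_n) (i k : 'I_n) : Prop :=
  [/\ odd i = odd k, w i < w k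
    & forall p : 'I_n, odd p != odd i -> w i < w p ->
      [&& ~~ (i < p < k), ~~ (k < p < i)
        & (i < p) || (k < p) ==> (w k < w p)]].

Lemma odd_diagram_swap (n : nat) (w : 'S_n) (i k : 'I_n) :
  swappable n w i k ->
  odd_diagram (tperm i k * w)%g = odd_diagram w.
Proof.
move=> [oik ltw none]; apply/setP=> -[q v].
rewrite -[v](permKV w); move: ((w^-1)%g v) => p.
rewrite mem_odd_diagram inE /= invMg tpermV !permM permK.
have odd_t (x : 'I_n) : odd (tperm i k x) = odd x by case: tpermP => [->|->|].
rewrite odd_t; case: (eqVneq (odd q) (odd p)) => [_|opq]; rewrite ?andbF ?andbT //.
have hp := none p; have hq := none q.
have e1 := perm_ltn_total _ w q i; have e2 := perm_ltn_total _ w q k.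
have e3 := perm_ltn_total _ w p i; have e4 := perm_ltn_total _ w p k.
case: (tpermP i k q) => [ea|ea|/e1 lai /e2 lak]; case: (tpermP i k p) => [eb|eb|/e3 lbi /e4 lbk];
  rewrite ?ea ?eb /= in opq hp hq *; unfold reverse_coercion in *;
  case: (boolP (odd q != odd i)) hq => oq hq;
  case: (boolP (odd p != odd i)) hp => op hp; lia.
Qed.

(** A position between i and k that carries an intermediate value inherits from
    k the right to be exchanged with i. *)
Lemma swappable_between (n : nat) (w : 'S_n) (i p k : 'I_n) :
  swappable n w i k -> i < p < k -> w i < w p < w k -> swappable n w i p.
Proof.
move=> [oik ltw none] /andP[ltip ltpk] /andP[ltwip ltwpk].
have oip : odd i = odd p.
  case: (eqVneq (odd p) (odd i)) => // /none/(_ ltwip).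
  by rewrite ltip ltpk.
split=> // q oqi ltiq; have := none q oqi ltiq.
unfold reverse_coercion in *; lia.
Qed.

(** * Classes with the positions of the small values prescribed *)

Definition prefix_class (n : nat) (w0 : 'S_n) (j : nat) : {set 'S_n} :=
  [set w | (odd_diagram w == odd_diagram w0) &&
           [forall p : 'I_n, (w0 p < j) ==> (w p == w0 p)]].

Lemma prefix_classP (n : nat) (w0 : 'S_n) (j : nat) (w : 'S_n) :
  reflect (odd_diagram w = odd_diagram w0 /\
           forall p : 'I_n, w0 p < j -> w p = w0 p)
          (w \in prefix_class n w0 j).
Proof.
rewrite inE; apply: (iffP andP) => -[/eqP-> agree]; split=> //.
  by move=> p ltp; apply/eqP/(implyP (forallP agree p)).
by apply/forallP=> p; apply/implyP=> /agree->.
Qed.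

Lemma prefix_class_refl (n : nat) (w : 'S_n) (j : nat) :
  w \in prefix_class n w j.
Proof. exact/prefix_classP. Qed.

Lemma prefix_class_sym (n : nat) (w w' : 'S_n) (j : nat) :
  w' \in prefix_class n w j -> w \in prefix_class n w' j.
Proof.
case/prefix_classP=> eqD agree; apply/prefix_classP; split=> // p ltp.
have eqv : w ((w^-1)%g (w' p)) = w' p by rewrite permKV.
have eqw' : w' ((w^-1)%g (w' p)) = w' p by rewrite agree eqv.
by move: eqv; rewrite (perm_inj eqw').
Qed.

Lemma prefix_class_trans (n : nat) (w w' w'' : 'S_n) (j : nat) :
  w' \in prefix_class n w j -> w'' \in prefix_class n w' j ->
  w'' \in prefix_class n w j.
Proof.
case/prefix_classP=> eqD agree /prefix_classP[eqD' agree'].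
apply/prefix_classP; split=> [|p ltp]; first by rewrite eqD'.
by rewrite agree' agree.
Qed.

Lemma prefix_class_eq (n : nat) (w w' : 'S_n) (j : nat) :
  w' \in prefix_class n w j -> prefix_class n w' j = prefix_class n w j.
Proof.
move=> w'K; apply/setP=> w''; apply/idP/idP; first exact: prefix_class_trans.
exact/prefix_class_trans/prefix_class_sym.
Qed.

(** The set of positions with a value at least j = w i is the same for w and w',
    so the conditions on p come from comparing the column j of the common
    diagram, and from (k, w p) not being in the diagram of w'. *)
Lemma prefix_class_exchange (n : nat) (w w' : 'S_n) (i k : 'I_n) :
  w' \in prefix_class n w (w i) -> w' k = w i -> i <> k -> swappable n w i k.
Proof.
move=> w'K w'k nik; case/prefix_classP: (w'K) => eqD agree.
have /prefix_classP[_ agree'] := prefix_class_sym _ _ _ _ w'K.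
have above p : p <> i -> p <> k -> (w i < w p) = (w i < w' p).
  move=> npi npk.
  have := agree p; have := agree' p.
  have /andP[_ h1] := perm_ltn_total _ w p i npi.
  have /andP[_ h2] := perm_ltn_total _ w' p k npk.
  rewrite w'k in h2; case: (ltnP (w p) (w i)) h1 => /= [lt _ _ e|_ h1 e _].
    by rewrite e // ltnNge (ltnW lt).
  rewrite h1; case: (ltnP (w' p) (w i)) h2 => //= lt _.
  by move: h1; rewrite e // ltnNge ltnW.
have ltik : w i < w k.
  have /andP[_] := perm_ltn_total _ w i k nik; case/orP => // lt.
  by case: nik; apply: (@perm_inj _ w); rewrite -(agree k lt).
have ltki : w i < w' i.
  have /andP[_] := perm_ltn_total _ w' i k nik; rewrite w'k; case/orP => // lt.
  by move: (agree' i lt) => e; rewrite -e ltnn in lt.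
have col q : [&& w i < w q, q < i & odd q != odd i]
           = [&& w i < w' q, q < k & odd q != odd k].
  by rewrite -mem_odd_diagram -eqD -w'k mem_odd_diagram w'k.
have oik : odd i = odd k.
  have /andP[] := perm_ltn_total _ w i k nik.
  case/orP=> lt _; apply/eqP.
    by move: (col i); rewrite ltnn ltki lt /=; case: eqP.
  by move: (col k); rewrite w'k ltik lt ltnn /= eq_sym; case: eqP.
split=> // p opi ltip.
have npi : p <> i by move=> e; rewrite e eqxx in opi.
have npk : p <> k by move=> e; rewrite e oik eqxx in opi.
have colp := col p; rewrite -above // ltip -oik opi !andbT /= in colp.
have npw : ~~ ((k < p) && (w p < w k)).
  apply/negP => /andP[ltkp ltpk].
  have : (k, w p) \in odd_diagram w.
    by rewrite mem_odd_diagram ltpk ltkp -oik eq_sym.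
  by rewrite -eqD inE /= w'k ltnNge (ltnW ltip).
have /andP[h1 _] := perm_ltn_total _ w p i npi.
have /andP[h2 h3] := perm_ltn_total _ w p k npk.
unfold reverse_coercion in *; lia.
Qed.

Lemma swappable_prefix_class (n : nat) (w : 'S_n) (i k : 'I_n) :
  swappable n w i k -> (tperm i k * w)%g \in prefix_class n w (w i).
Proof.
move=> swap; have [_ ltik _] := swap.
apply/prefix_classP; split; first exact: odd_diagram_swap.
move=> p ltp; rewrite permM tpermD //; apply/eqP=> e; move: ltp; rewrite -e.
  by rewrite ltnn.
by rewrite ltnNge ltnW.
Qed.

Lemma swap_mem_prefix_class (n : nat) (w0 w w' : 'S_n) (j i k : 'I_n) :
  w \in prefix_class n w0 j -> w i = j ->
  w' \in prefix_class n w0 j -> w' k = j ->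
  (tperm i k * w)%g \in prefix_class n w0 j.
Proof.
move=> wK wi; rewrite -(prefix_class_eq _ _ _ _ wK) -wi => w'K w'k.
case: (eqVneq i k) => [<-|/eqP nik].
  by rewrite tperm1 mul1g prefix_class_refl.
exact/swappable_prefix_class/(prefix_class_exchange _ _ _ _ _ w'K).
Qed.

(** * Summing over the position of the next value *)

Local Open Scope ring_scope.

(** The last hypothesis says that i and k are consecutive among the positions
    that the value j takes in the prefix class. *)
Lemma prefix_class_sum_shift (n : nat) (w0 : 'S_n) (j i k : 'I_n) :
  (exists2 w, w \in prefix_class n w0 j & w i = j) ->
  (exists2 w, w \in prefix_class n w0 j & w k = j) ->
  (i < k)%N ->
  (forall p : 'I_n, (i < p < k)%N ->
     forall w, w \in prefix_class n w0 j -> w p <> j) ->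
  \sum_(w in prefix_class n w0 j | w k == j) 'X^(coxeter_length w)
  = 'X * \sum_(w in prefix_class n w0 j | w i == j) 'X^(coxeter_length w)
  :> {poly int}.
Proof.
move=> [wi wiK wij] [wk wkK wkj] ltik none.
have back w : (tperm i k * w)%g \in prefix_class n w0 j -> w i = j ->
    w \in prefix_class n w0 j.
  move=> twK wj; have := swap_mem_prefix_class _ _ _ _ j k i twK _ wiK wij.
  by rewrite permM tpermR tpermC mulgA tperm2 mul1g; apply.
rewrite (reindex_inj (mulgI (tperm i k))) mulr_sumr /=.
apply: eq_big => [w|w /andP[twK]]; rewrite permM tpermR.
  apply: andb_id2r => /eqP wj; apply/idP/idP => wK; first exact: back.
  exact: swap_mem_prefix_class wK wj wkK wkj.
move/eqP=> wj; have wK := back w twK wj.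
rewrite -exprS; congr ('X^_).
have nik : i <> k by move=> e; rewrite e ltnn in ltik.
have wkK' := wkK; rewrite -(prefix_class_eq _ _ _ _ wK) -wj in wkK'.
have swap := prefix_class_exchange _ _ _ _ _ wkK' (etrans wkj (esym wj)) nik.
have [_ ltw _] := swap.
apply: coxeter_length_cover => // p bp; apply/negP=> bwp.
have tK := swappable_prefix_class _ _ _ _ (swappable_between _ _ _ _ _ swap bp bwp).
rewrite wj (prefix_class_eq _ _ _ _ wK) in tK.
by apply: (none p bp _ tK); rewrite permM tpermR.
Qed.

(** A family that gets multiplied by x from each element of E to the next one is
    a geometric progression, starting at the least element of E. *)
Lemma sum_consecutive (R : nzRingType) (n : nat) (x : R) (F : 'I_n -> R)
    (E : {set 'I_n}) (e0 : 'I_n) :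
  e0 \in E -> (forall e, e \in E -> e0 <= e)%N ->
  (forall e e', e \in E -> e' \in E -> (e < e')%N ->
     (forall p : 'I_n, (e < p < e')%N -> p \notin E) -> F e' = x * F e) ->
  \sum_(e in E) F e = (\sum_(0 <= k < #|E|) x ^+ k) * F e0.
Proof.
move=> e0E; have [m] := ubnP #|E|; elim: m E e0 e0E => // m IH E e0 e0E ltm min step.
rewrite (big_setD1 e0) //= (cardsD1 e0) e0E big_nat_recl // expr0 mulrDl mul1r.
congr (_ + _).
have [->|[x0 x0E]] := set_0Vmem (E :\ e0).
  by rewrite big_set0 cards0 big_geq ?mul0r.
have [e1 e1E min1] := @arg_minnP _ x0 (mem (E :\ e0)) (@nat_of_ord n) x0E.
have /setD1P[ne10 e1E'] := e1E.
have lt01 : (e0 < e1)%N by rewrite ltn_neqAle min // andbT eq_sym.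
rewrite (IH _ e1) //=.
- rewrite (step e0 e1) //.
    by rewrite mulrA; congr (_ * _); rewrite mulr_suml; apply: eq_bigr=> k _; rewrite -exprSr.
  move=> p /andP[lt0p ltp1]; apply/negP=> pE.
  have := min1 p; rewrite !inE pE andbT leqNgt ltp1 /=.
  by rewrite -val_eqE gtn_eqF // => /(_ isT).
- by move: ltm; rewrite (cardsD1 e0) e0E.
move=> e e' /setD1P[_ eE] /setD1P[_ e'E] lte none; apply: step => // p bp.
have := none p bp; rewrite !inE negb_and negbK => /orP[/eqP ep|//].
by have /andP[] := bp; rewrite ep ltnNge min.
Qed.

(** The exponent is given as the length of a member of the class so that it can
    be compared with the least length that occurs. *)
Lemma prefix_class_sum (n : nat) (w0 : 'S_n) (j : nat) : (j <= n)%N ->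
  exists2 w, w \in prefix_class n w0 j & exists ms : seq nat,
    \sum_(w' in prefix_class n w0 j) 'X^(coxeter_length w')
    = 'X^(coxeter_length w) * \prod_(m <- ms) \sum_(0 <= k < m.+1) 'X^k
    :> {poly int}.
Proof.
move=> lejn; have [d] := ubnP (n - j); elim: d j w0 lejn => // d IH j w0 lejn ltd.
move: lejn; rewrite leq_eqVlt => /predU1P[->|ltjn].
  exists w0; first exact: prefix_class_refl.
  exists [::]; rewrite big_nil mulr1 (_ : prefix_class n w0 n = [set w0]).
    by rewrite big_set1.
  apply/setP=> w; rewrite in_set1; apply/idP/eqP => [/prefix_classP[_ h]|->].
    by apply/permP=> p; apply: h.
  exact: prefix_class_refl.
pose v : 'I_n := Ordinal ltjn.
pose E := [set (w^-1)%g v | w : 'S_n in prefix_class n w0 j].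
have [e0 e0E min] := @arg_minnP _ ((w0^-1)%g v) (mem E) (@nat_of_ord n)
                      (imset_f _ (prefix_class_refl _ _ _)).
have memE e : reflect (exists2 w, w \in prefix_class n w0 v & w e = v) (e \in E).
  apply: (iffP imsetP) => -[w wK e_w]; exists w => //; first by rewrite e_w permKV.
  by rewrite -e_w permK.
have /memE[w1 w1K w1e0] := e0E.
(* Prescribing the least possible position e0 for the value j turns the prefix
   class into one for j.+1. *)
have [w wK [ms sumE]] := IH j.+1 w1 ltjn ltac:(lia).
have subK : prefix_class n w1 j.+1
            = [set w in prefix_class n w0 j | w e0 == v].
  rewrite -(prefix_class_eq _ _ _ _ w1K); apply/setP=> w'; rewrite inE.
  apply/prefix_classP/andP => [[eqD agree]|[/prefix_classP[eqD agree] /eqP we0]].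
    split; last by rewrite agree w1e0.
    by apply/prefix_classP; split=> // p ltp; apply: agree; apply: ltnW.
  split=> // p; rewrite ltnS leq_eqVlt => /predU1P[e|/agree//].
  have -> : p = e0 by apply: (@perm_inj _ w1); rewrite w1e0; apply: val_inj.
  by rewrite we0.
exists w.
  by move: wK; rewrite subK inE => /andP[].
exists (#|E|.-1 :: ms); rewrite big_cons mulrCA -sumE prednK; last first.
  by apply/card_gt0P; exists e0.
have -> : \sum_(w' in prefix_class n w1 j.+1) 'X^(coxeter_length w')
   = \sum_(w' in prefix_class n w0 v | w' e0 == v) 'X^(coxeter_length w')
   :> {poly int} by apply: eq_bigl => w'; rewrite subK inE.
rewrite -(sum_consecutive _ _ _ (fun e => \sum_(w' in prefix_class n w0 v
                                    | w' e == v) 'X^(coxeter_length w'))) //.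
  rewrite (partition_big (fun w : 'S_n => (w^-1)%g v) (mem E)) /=; last first.
    by move=> w' w'K; apply: imset_f.
  apply: eq_bigr => e _; apply: eq_bigl => w'; congr (_ && _).
  by rewrite -(inj_eq (@perm_inj _ w')) permKV eq_sym.
move=> e e' /memE eE /memE e'E lte none; apply: prefix_class_sum_shift => // p bp w' w'K w'p.
by have /negP[] := none p bp; apply/memE; exists w'.
Qed.

Theorem theorem1p3 (n : nat) (n_gt0 : (0 < n)%N)
    (D : {set 'I_n * 'I_n}) (D_odd : is_odd_diagram D)
    (u v : 'S_n) (class_uv : odd_diagram_class D = bruhat_interval u v) :
  exists ms : seq nat,
    poincare u v = \prod_(m <- ms) \sum_(0 <= k < m.+1) 'X^k.
Proof.
(* With no prescribed value, a prefix class is an odd diagram class. *)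
have [w0 w0D] := D_odd.
have classE : bruhat_interval u v = prefix_class n w0 0.
  rewrite -class_uv; apply/setP=> w; rewrite !inE w0D.
  by rewrite [X in _ = _ && X](_ : _ = true) ?andbT //; apply/forallP.
have [w wK [ms sumE]] := prefix_class_sum n w0 0 (leq0n n).
exists ms; rewrite -classE in wK sumE.
have uI : u \in bruhat_interval u v.
  move: wK; rewrite !inE => /andP[le_uw le_wv].
  by rewrite /bruhat_le connect0 (connect_trans le_uw le_wv).
have le_uw : (coxeter_length u <= coxeter_length w)%N.
  by move: wK; rewrite inE => /andP[/bruhat_le_length].
(* If w were longer than u, then X^(l(w)) would divide the sum, whose coefficient
   at X^(l(u)) is positive. *)
have lenE : coxeter_length w = coxeter_length u.
  apply/eqP; rewrite eqn_leq le_uw andbT leqNgt; apply/negP=> lt_uw.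
  move/(congr1 (fun p : {poly int} => p`_(coxeter_length u))): sumE.
  rewrite coefXnM lt_uw coef_sum (bigD1 u) //= coefXn eqxx.
  apply/eqP/lt0r_neq0; rewrite ltr_pwDl ?ltr01 // sumr_ge0 // => x _.
  by rewrite coefXn ler0n.
apply: (@mulfI _ 'X^(coxeter_length u)); first by rewrite expf_neq0 ?polyX_eq0.
by rewrite poincareE sumE lenE.
Qed.
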